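(* Let $(X,\|\cdot\|)$ be a Banach space and let $T:X\rightarrow X$ be an enriched $(b,\theta,L)$-almost contraction, where $b\in[0,\infty)$, $\theta\in(0,b+1)$ and $L\ge 0$. Put $\delta=\dfrac{\theta}{b+1}$. Then: 1) $Fix(T)\neq\emptyset$. Moreover, there exists $\lambda\in(0,1)$ such that for every $x_0\in X$ the Krasnoselskij iteration $\{x_n\}_{n\ge 0}$ defined by $$x_{n+1}=(1-\lambda)x_n+\lambda T x_n,\quad n\geq 0,$$ has the following properties: 2) $\{x_n\}$ converges (in norm) to some $x^\ast\in Fix(T)$; 3) with this $x^\ast$, $$\|x_{n+i-1}-x^\ast\|\leq\frac{\delta^i}{1-\delta}\,\|x_n-x_{n-1}\|,\quad n=1,2,\dots;\ i=1,2,\dots$$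
   Context: For a map $T:X\to X$, $Fix(T)=\{x\in X: Tx=x\}$. Definition. Let $(X,\|\cdot\|)$ be a normed linear space, $b\in[0,\infty)$, $\theta\in(0,b+1)$ and $L\geq 0$. A mapping $T:X\rightarrow X$ is called an enriched $(b,\theta,L)$-almost contraction if $$\|b(x-y)+Tx-Ty\|\leq \theta \|x-y\|+L\|b(x-y)+Tx-y\|\quad\text{for all } x,y\in X.$$
   Formalization: For b = 0 the value λ = 1 is also allowed (λ in (0,1] instead of (0,1)), since the claim with λ < 1 fails there, e.g. for Tx = x/2 on the reals with θ = 1/2, L = 0; for b > 0 the claim is as stated. *)

(* Defs.v *)
From mathcomp Require Import all_boot all_order all_algebra.
From mathcomp Require Import all_classical all_reals all_analysis.
Set Implicit Arguments.
Unset Strict Implicit.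
Unset Printing Implicit Defensive.
Import Order.TTheory GRing.Theory Num.Theory.
Import numFieldNormedType.Exports.
Local Open Scope classical_set_scope.
Local Open Scope ring_scope.

Definition fixpoints (X : Type) (T : X -> X) : set X := [set x | T x = x].

Definition enriched_almost_contraction (R : realType) (X : normedModType R)
    (b theta L : R) (T : X -> X) : Prop :=
  [/\ 0 <= b, 0 < theta < b + 1, 0 <= L &
    forall x y : X,
      `|b *: (x - y) + T x - T y| <=
        theta * `|x - y| + L * `|b *: (x - y) + T x - y|].

(* For lambda = 1 this is the Picard iteration of T.  That endpoint cannot be
   avoided for b = 0: if T x = theta *: x on R, then for lambda < 1 the iterates
   decay like (1 - lambda * (1 - theta)) ^+ n, more slowly than theta ^+ n. *)
Definition krasnoselskij (R : realType) (X : normedModType R)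
    (lambda : R) (T : X -> X) (x0 : X) : nat -> X :=
  fun n => iter n (fun x => (1 - lambda) *: x + lambda *: T x) x0.

(* Main.v *)
(* With lambda = 1 / (b + 1), the map S x = (1 - lambda) x + lambda T x has the
   same fixed points as T, and dividing the enriched condition by b + 1 gives
   |S x - S y| <= delta |x - y| + L |S x - y|. The last term vanishes for
   y = S x, so consecutive increments of the iteration shrink by delta; the
   iterates are thus Cauchy with geometric tails, and the condition at y the
   limit shows that the limit is fixed by S. *)
Require Import Defs.
From mathcomp Require Import all_boot all_order all_algebra.
From mathcomp Require Import all_classical all_reals all_analysis.
From mathcomp Require Import lra.
Import Order.TTheory GRing.Theory Num.Theory.
Import numFieldNormedType.Exports.
Local Open Scope classical_set_scope.
Local Open Scope ring_scope.

Section geometric_increments.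
Variables (R : realType) (d : R).
Hypothesis d01 : 0 <= d < 1.

Lemma geometric_increments_bound (V : normedModType R) (u : nat -> V) :
  (forall n, `|u n.+2 - u n.+1| <= d * `|u n.+1 - u n|) ->
  forall m k, `|u (m + k).+1 - u (m + k)%N| <= d ^+ k * `|u m.+1 - u m|.
Proof.
move=> du m; elim=> [|k IHk]; first by rewrite addn0 expr0 mul1r.
have /andP[d0 _] := d01.
by rewrite addnS exprS -mulrA (le_trans (du _)) // ler_wpM2l.
Qed.

(** Induction on [k] with [m] free: after a first increment of norm [a], the rest of the path starts
    with an increment of norm at most [d * a], and [a + d * a / (1 - d) = a / (1 - d)]. The bound is
    uniform in [k], so it survives a passage to the limit. *)
Lemma geometric_increments_dist (V : normedModType R) (u : nat -> V) :
  (forall n, `|u n.+2 - u n.+1| <= d * `|u n.+1 - u n|) ->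
  forall m k, `|u (m + k)%N - u m| <= `|u m.+1 - u m| / (1 - d).
Proof.
have /andP[d0 d1] := d01; have d1' : 0 < 1 - d by rewrite subr_gt0.
move=> du m k; elim: k m => [|k IHk] m.
  by rewrite addn0 subrr normr0 divr_ge0 // ltW.
rewrite -addSnnS -(subrKA (u m.+1)) (le_trans (ler_normD _ _)) //.
rewrite (le_trans (lerD (IHk m.+1) (lexx _))) //.
rewrite ler_pdivlMr // mulrDl divfK ?gt_eqF //.
by have := du m; lra.
Qed.

(** The telescoping series of [u] is dominated in norm by a geometric series, and completeness of
    [V] turns absolute convergence into convergence. *)
Lemma geometric_increments_cvg (V : completeNormedModType R) (u : nat -> V) :
  (forall n, `|u n.+2 - u n.+1| <= d * `|u n.+1 - u n|) -> cvgn u.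
Proof.
move=> du; have /andP[d0 d1] := d01.
have cs : cvgn (series (telescope u)).
  apply: normed_cvg; apply: (@series_le_cvg _ _ (geometric `|u 1%N - u 0%N| d)).
  - by move=> n /=.
  - by move=> n; exact: geometric_ge0.
  - move=> n /=; rewrite /telescope mulrC.
    exact: (geometric_increments_bound _ u du 0 n).
  - by apply: is_cvg_geometric_series; rewrite ger0_norm.
rewrite (_ : u = cst (u 0%N) + series (telescope u)); last first.
  by apply/funext => n; rewrite [LHS]eq_sum_telescope.
by apply: is_cvgD => //; exact: is_cvg_cst.
Qed.

(** The uniform distance bound is used from index [m + i] on, with the far end sent to the limit;
    the factor [d ^+ i] comes from comparing the increment at [m + i] with the one at [m]. *)
Lemma geometric_increments_limit (V : normedModType R) (u : nat -> V) (l : V) :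
  (forall n, `|u n.+2 - u n.+1| <= d * `|u n.+1 - u n|) ->
  u n @[n --> \oo] --> l ->
  forall m i, `|u (m + i)%N - l| <= d ^+ i / (1 - d) * `|u m.+1 - u m|.
Proof.
move=> du ul m i; have /andP[d0 d1] := d01.
have d1' : 0 < 1 - d by rewrite subr_gt0.
set v := u (m + i)%N.
have vl : `|u (k + (m + i))%N - v| @[k --> \oo] --> `|l - v|.
  apply: cvg_norm; apply: cvgB; last exact: cvg_cst.
  by rewrite (cvg_shiftn (m + i) u).
rewrite distrC (@le_trans _ _ (`|u (m + i).+1 - v| / (1 - d))) //.
  apply: (cvgr_to_le vl); apply: nearW => k; rewrite addnC.
  exact: geometric_increments_dist.
rewrite mulrAC ler_wpM2r ?invr_ge0 ?(ltW d1') //.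
exact: geometric_increments_bound.
Qed.

End geometric_increments.

Section averaged_map.
Variables (R : realType) (X : normedModType R) (b : R) (T : X -> X).
Hypothesis b0 : 0 <= b.

Let lambda := (b + 1)^-1.
Let S x := (1 - lambda) *: x + lambda *: T x.

Let b1_gt0 : 0 < b + 1. Proof. by rewrite ltr_wpDl. Qed.

Let scale_averaged x : (b + 1) *: S x = b *: x + T x.
Proof.
rewrite scalerDr !scalerA mulrBr mulr1 divff ?gt_eqF // scale1r.
by rewrite addrK.
Qed.

Lemma averaged_fixpoint x : S x = x -> T x = x.
Proof.
move=> Sx; have := scale_averaged x.
by rewrite Sx scalerDl scale1r => /addrI.
Qed.

(** Both left-hand vectors of the enriched condition are multiples by [b + 1], of [S x - S y] and of
    [S x - y]. Cancelling this factor divides [theta] by [b + 1] but leaves [L] unchanged, since the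
    [L] term carries the factor too. *)
Lemma averaged_almost_contraction (theta L : R) :
  enriched_almost_contraction b theta L T ->
  forall x y, `|S x - S y| <= theta / (b + 1) * `|x - y| + L * `|S x - y|.
Proof.
move=> [_ _ _ hT] x y.
have e1 : b *: (x - y) + T x - T y = (b + 1) *: (S x - S y).
  by rewrite [RHS]scalerBr !scale_averaged scalerBr opprD addrACA addrA.
have e2 : b *: (x - y) + T x - y = (b + 1) *: (S x - y).
  rewrite [RHS]scalerBr scale_averaged scalerDl scale1r scalerBr opprD addrA.
  by rewrite -!addrA; congr (_ + _); rewrite addrCA.
have := hT x y; rewrite e1 e2 !normrZ (gtr0_norm b1_gt0) => h.
rewrite -(ler_pM2l b1_gt0) (le_trans h) // mulrDr (mulrA _ (theta / _)).
by rewrite (mulrC _ (theta / _)) divfK ?gt_eqF // [L * _]mulrCA.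
Qed.

End averaged_map.

(** With [x = u n] and [y = l], the right-hand side tends to 0, so [u n.+1] tends to [S l] as well
    as to [l], and limits are unique. *)
Lemma almost_contraction_limit_fixed (R : realType) (X : normedModType R)
    (d L : R) (S : X -> X) (u : nat -> X) (l : X) :
  (forall x y, `|S x - S y| <= d * `|x - y| + L * `|S x - y|) ->
  (forall n, u n.+1 = S (u n)) -> u n @[n --> \oo] --> l -> S l = l.
Proof.
move=> hS uS ul.
have ul1 : u n.+1 @[n --> \oo] --> l by rewrite cvg_shiftS.
have distu0 (v : nat -> X) :
    v n @[n --> \oo] --> l -> `|v n - l| @[n --> \oo] --> (0 : R).
  by move=> vl; apply/norm_cvg0P; apply/subr_cvg0.
have e0 : (d * `|u n - l| + L * `|u n.+1 - l|) @[n --> \oo] --> (0 : R).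
  rewrite -[X in _ --> X](addr0 0) -[X in X + _](mulr0 d) -[X in _ + X](mulr0 L).
  by apply: cvgD; apply: cvgM; try exact: cvg_cst; exact: distu0.
apply: (cvg_unique (@norm_hausdorff R X)) ul1.
apply/subr_cvg0/norm_cvg0P.
apply: (squeeze_cvgr _ (cvg_cst (0 : R)) e0).
by apply: nearW => n; rewrite normr_ge0 uS hS.
Qed.

Theorem theorem4 (R : realType) (X : completeNormedModType R)
    (b theta L : R) (T : X -> X)
    (hb : 0 <= b) (htheta : 0 < theta < b + 1) (hL : 0 <= L)
    (hT : enriched_almost_contraction b theta L T) :
  let delta := theta / (b + 1) in
  fixpoints T !=set0 /\
  exists lambda : R,
    [/\ 0 < lambda <= 1,
        (0 < b -> lambda < 1) &
        forall x0 : X,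
          let x := krasnoselskij lambda T x0 in
          exists xstar : X,
            [/\ fixpoints T xstar,
                x n @[n --> \oo] --> xstar &
                forall n i : nat, (1 <= n)%N -> (1 <= i)%N ->
                  `|x (n + i - 1)%N - xstar| <=
                    delta ^+ i / (1 - delta) * `|x n - x (n - 1)%N| ] ].
Proof.
move=> delta; have b1 : 0 < b + 1 by rewrite ltr_wpDl.
have /andP[t0 tb] := htheta.
have d01 : 0 <= delta < 1.
  by rewrite divr_ge0 ?(ltW t0) ?(ltW b1) //= ltr_pdivrMr // mul1r.
pose lambda := (b + 1)^-1.
have main x0 : let x := krasnoselskij lambda T x0 in
    exists xstar : X, [/\ fixpoints T xstar, x n @[n --> \oo] --> xstar &
      forall n i : nat, (1 <= n)%N -> (1 <= i)%N ->
        `|x (n + i - 1)%N - xstar| <=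
          delta ^+ i / (1 - delta) * `|x n - x (n - 1)%N|].
  move=> x; have hS := averaged_almost_contraction _ _ _ _ hb _ _ hT.
  have dx n : `|x n.+2 - x n.+1| <= delta * `|x n.+1 - x n|.
    (* [S (x n)] is convertible to [x n.+1]; folding it exposes the [L] term as the norm of
       [x n.+1 - x n.+1]. *)
    have := hS (x n) (x n.+1); rewrite -!/(x _) subrr normr0 mulr0 addr0.
    by rewrite distrC [in X in _ <= X]distrC.
  have xl := geometric_increments_cvg _ _ d01 _ _ dx.
  exists (limn x); split => //.
    apply: (averaged_fixpoint _ _ _ _ hb).
    exact: (almost_contraction_limit_fixed _ _ _ _ _ _ _ hS _ xl).
  (* Writing the positive index as [n.+1] removes the truncated subtractions: the base increment is
     the one at [n], and the estimated term is [x (n + i)]. *)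
  move=> [//|n] i _ _; rewrite addSn !subn1 /=.
  exact: geometric_increments_limit.
(* Existence of a fixed point follows by running the iteration from the arbitrary starting point
   0. *)
split; first by have [xs [fx _ _]] := main 0; exists xs.
exists lambda; split => //.
- by rewrite invr_gt0 b1 invf_le1 // lerDr.
- by move=> bgt0; rewrite invf_lt1 // ltrDr.
Qed.
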